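(* Let $F,T:[0,1]\to\mathcal{K}(\mathbb{R})$ be set-valued Lipschitz maps with Lipschitz constant $l$. Then $\dim_H(\mathcal{G}(F+T))=\dim_H(\mathcal{G}(T))$, where $(F+T)(u):=F(u)+T(u)$ and $F(u)+T(u)$ denotes the Minkowski sum of $F(u)$ and $T(u)$.
   Context: $\mathcal{K}(\mathbb{R})$ is the collection of nonempty compact subsets of $\mathbb{R}$, with the Hausdorff metric $H_d$. Lipschitz with constant $l$ means $H_d(F(u),F(w))\le l|u-w|$ for all $u,w$. The Minkowski sum is $A+B=\{a+b:a\in A,b\in B\}$. The graph of $F$ is $\mathcal{G}(F)=\{(u,F(u)):u\in[0,1]\}\subset[0,1]\times\mathcal{K}(\mathbb{R})$ (pairs of a number and a compact set), with metric $D_{\mathcal{G}}((u,F(u)),(w,F(w)))=|u-w|+H_d(F(u),F(w))$; $\dim_H$ is the Hausdorff dimension with respect to $D_{\mathcal{G}}$. *)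

(* Defs.v *)
From HB Require Import structures.
From mathcomp Require Import all_boot all_order all_algebra.
From mathcomp Require Import boolp classical_sets functions reals ereal.
From mathcomp Require Import topology normedtype sequences exp.

Set Implicit Arguments.
Unset Strict Implicit.
Unset Printing Implicit Defensive.

Import Order.TTheory GRing.Theory Num.Theory.
Import numFieldNormedType.Exports.

Local Open Scope classical_set_scope.
Local Open Scope ring_scope.

Record compacts (R : realType) := Compacts {
  compacts_set :> set R ;
  compacts_compact : compact compacts_set ;
  compacts_nonempty : compacts_set !=set0 }.

Arguments compacts_compact {R} _ [F] _ _.
Arguments compacts_nonempty {R} _.

HB.instance Definition _ (R : realType) := gen_eqMixin (compacts R).
HB.instance Definition _ (R : realType) := gen_choiceMixin (compacts R).

Lemma compacts_inj (R : realType) (A B : compacts R) :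
  A = B :> set R -> A = B.
Proof.
case: A B => A cA A0 [B cB B0] /= AB; subst B.
by rewrite (Prop_irrelevance cA cB) (Prop_irrelevance A0 B0).
Qed.

Section hausdorff_metric.
Context {R : realType}.
Implicit Types (x : R) (A B C : compacts R).

Definition dist_to_set x (B : set R) : R := inf [set `|x - b| | b in B].

Definition excess (A B : set R) : R := sup [set dist_to_set a B | a in A].

(* The values of [sup] and [inf] are meaningful because both sets are nonempty
   and bounded. *)
Definition hausdorff_dist A B : R := Num.max (excess A B) (excess B A).

Lemma dist_to_set_le x B b : compacts_set B b -> dist_to_set x B <= `|x - b|.
Proof.
move=> Bb; apply: ge_inf; last by exists b.
by exists 0 => _ [c _ <-].
Qed.

Lemma dist_to_set_has_inf x B : has_inf [set `|x - b| | b in B].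
Proof.
split; last by exists 0 => _ [c _ <-].
by have [b Bb] := compacts_nonempty B; exists `|x - b|, b.
Qed.

Lemma dist_to_set_ge0 x B : 0 <= dist_to_set x B.
Proof.
by apply: lb_le_inf; [have [] := dist_to_set_has_inf x B | move=> _ [c _ <-]].
Qed.

Lemma dist_to_set_adherent x B (e : R) : 0 < e ->
  exists2 b, compacts_set B b & `|x - b| < dist_to_set x B + e.
Proof.
move=> e0; have [_ [b Bb <-] xb] := inf_adherent e0 (dist_to_set_has_inf x B).
by exists b.
Qed.

Lemma excess_has_sup A B : has_sup [set dist_to_set a B | a in A].
Proof.
have [a0 Aa0] := compacts_nonempty A; have [b0 Bb0] := compacts_nonempty B.
split; first by exists (dist_to_set a0 B), a0.
have [M [_ MA]] := compact_bounded (compacts_compact A).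
exists (M + 1 + `|b0|) => _ [a Aa <-].
apply: (le_trans (dist_to_set_le a Bb0)); apply: (le_trans (ler_normB _ _)).
by rewrite lerD2r; apply: MA => //; rewrite ltrDl.
Qed.

Lemma dist_to_set_excess A B x : compacts_set A x ->
  dist_to_set x B <= excess A B.
Proof.
move=> Ax; apply: ub_le_sup; last by exists x.
by have [] := excess_has_sup A B.
Qed.

Lemma excess_le A B (c : R) :
  (forall a, compacts_set A a -> dist_to_set a B <= c) -> excess A B <= c.
Proof.
move=> ABc; apply: ge_sup; first by have [] := excess_has_sup A B.
by move=> _ [a Aa <-]; exact: ABc.
Qed.

Lemma excess_ge0 A B : 0 <= excess A B.
Proof.
have [a Aa] := compacts_nonempty A.
exact: le_trans (dist_to_set_ge0 a B) (dist_to_set_excess B Aa).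
Qed.

Lemma excess_triangle B A C : excess A C <= excess A B + excess B C.
Proof.
apply: excess_le => a Aa; apply/ler_addgt0Pr => e e0.
have e20 : 0 < e / 2 by rewrite divr_gt0.
have [b Bb ab] := dist_to_set_adherent a B e20.
have [c Cc bc] := dist_to_set_adherent b C e20.
apply: (le_trans (dist_to_set_le a Cc)).
apply: (le_trans (ler_distD b a c)).
apply: (le_trans (lerD (ltW ab) (ltW bc))).
by rewrite addrACA -splitr lerD2r lerD// dist_to_set_excess.
Qed.

Lemma excess_xx A : excess A A = 0.
Proof.
apply/eqP; rewrite eq_le excess_ge0 andbT; apply: excess_le => a Aa.
by apply: (le_trans (dist_to_set_le a Aa)); rewrite subrr normr0.
Qed.

Lemma excess0_subset A B : excess A B = 0 -> A `<=` B.
Proof.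
move=> AB0 a Aa.
apply: (compact_closed (@Rhausdorff R) (compacts_compact B)).
move=> V /nbhs_ballP[e /= e0 eV].
have [b Bb ab] := dist_to_set_adherent a B e0.
exists b; split => //; apply: eV; rewrite /ball /=.
apply: (lt_le_trans ab); rewrite -[leRHS]add0r lerD2r -AB0.
exact: dist_to_set_excess.
Qed.

Lemma hausdorff_dist_xx A : hausdorff_dist A A = 0.
Proof. by rewrite /hausdorff_dist excess_xx maxxx. Qed.

Lemma hausdorff_dist_eq0 A B : hausdorff_dist A B = 0 -> A = B.
Proof.
move=> AB0; have : hausdorff_dist A B <= 0 by rewrite AB0.
rewrite ge_max => /andP[AB BA].
apply: compacts_inj; apply/seteqP; split; apply: excess0_subset;
  by apply/eqP; rewrite eq_le excess_ge0 andbT.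
Qed.

Lemma hausdorff_distC A B : hausdorff_dist A B = hausdorff_dist B A.
Proof. by rewrite /hausdorff_dist maxC. Qed.

Lemma hausdorff_dist_triangle B A C :
  hausdorff_dist A C <= hausdorff_dist A B + hausdorff_dist B C.
Proof.
rewrite /hausdorff_dist ge_max; apply/andP; split.
  by apply: (le_trans (excess_triangle B A C)); rewrite lerD// le_max lexx.
apply: (le_trans (excess_triangle B C A)).
by rewrite addrC lerD// le_max lexx orbT.
Qed.

End hausdorff_metric.

HB.instance Definition _ (R : realType) := @isMetric.Build R (compacts R)
  hausdorff_dist hausdorff_dist_xx hausdorff_dist_eq0 hausdorff_distC
  hausdorff_dist_triangle.

Lemma compacts_mdistE (R : realType) (A B : compacts R) :
  mdist A B = Num.max (excess A B) (excess B A).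
Proof. by []. Qed.

Section minkowski_sum.
Context {R : realType}.
Implicit Types A B : compacts R.

Definition minkowski_set (A B : set R) : set R :=
  [set a + b | a in A & b in B].

Lemma minkowski_compact A B : compact (minkowski_set A B).
Proof.
have -> : minkowski_set A B = (fun x : R * R => x.1 + x.2) @` (A `*` B).
  apply/seteqP; split => [_ [a Aa [b Bb <-]]|_ [[a b] [/= Aa Bb] <-]].
    by exists (a, b).
  by exists a => //; exists b.
apply: continuous_compact.
  by apply: continuous_subspaceT; exact: add_continuous.
by apply: compact_setX; exact: compacts_compact.
Qed.

Lemma minkowski_nonempty A B : minkowski_set A B !=set0.
Proof.
have [a Aa] := compacts_nonempty A; have [b Bb] := compacts_nonempty B.
by exists (a + b), a => //; exists b.
Qed.

Definition minkowski_sum A B : compacts R :=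
  Compacts (@minkowski_compact A B) (@minkowski_nonempty A B).

End minkowski_sum.

(* A synonym of [R * compacts R], carrying the sum metric rather than the max
   (pseudo)metric of the product. *)
Definition graph_space (R : realType) : Type := (R * compacts R)%type.

HB.instance Definition _ (R : realType) := Choice.on (graph_space R).

Section graph_metric.
Context {R : realType}.
Implicit Types p q r : graph_space R.

Definition graph_dist p q : R := `|p.1 - q.1| + mdist p.2 q.2.

Lemma graph_dist_xx p : graph_dist p p = 0.
Proof. by rewrite /graph_dist subrr normr0 mdistxx addr0. Qed.

Lemma graph_dist_eq0 p q : graph_dist p q = 0 -> p = q.
Proof.
case: p q => [u A] [w B] /eqP; rewrite /graph_dist /= paddr_eq0 ?mdist_ge0//.
by rewrite normr_eq0 subr_eq0 => /andP[/eqP -> /eqP/mdist_positivity ->].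
Qed.

Lemma graph_distC p q : graph_dist p q = graph_dist q p.
Proof. by rewrite /graph_dist distrC metric_sym. Qed.

Lemma graph_dist_triangle q p r :
  graph_dist p r <= graph_dist p q + graph_dist q r.
Proof.
by rewrite /graph_dist addrACA lerD ?ler_distD// metric_triangle.
Qed.

End graph_metric.

HB.instance Definition _ (R : realType) := @isMetric.Build R (graph_space R)
  graph_dist graph_dist_xx graph_dist_eq0 graph_distC graph_dist_triangle.

Lemma graph_mdistE (R : realType) (p q : graph_space R) :
  mdist p q = `|p.1 - q.1| + mdist p.2 q.2.
Proof. by []. Qed.

Section set_valued_maps.
Context {R : realType}.

(* Maps with domain [0, 1] are represented by total functions, whose values
   outside [0, 1] are never used. *)
Implicit Types F T : R -> compacts R.

Definition lipschitz01 (l : R) F : Prop :=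
  forall u w : R, 0 <= u <= 1 -> 0 <= w <= 1 ->
    mdist (F u) (F w) <= l * `|u - w|.

Definition minkowski_fun F T : R -> compacts R :=
  fun u => minkowski_sum (F u) (T u).

Definition graph01 F : set (graph_space R) :=
  [set ((u, F u) : graph_space R) | u in [set u : R | 0 <= u <= 1]].

End set_valued_maps.

Section hausdorff_dimension.
Context {R : realType} {M : metricType R}.
Implicit Types (s delta : R) (A U : set M).
Local Open Scope ereal_scope.

Definition diam U : \bar R :=
  ereal_sup (0 |` [set (mdist x y)%:E | x in U & y in U]).

(* |U|^s, with 0^0 = 1 for nonempty U and the empty set always contributing 0:
   for s = 0 this yields the counting measure. *)
Definition diam_pow s U : \bar R :=
  if U == set0 then 0 else diam U `^ s.

Definition delta_cover delta A : set ((set M)^nat) :=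
  [set U | A `<=` \bigcup_k U k /\ forall k, diam (U k) <= delta%:E].

Definition hausdorff_premeasure s delta A : \bar R :=
  ereal_inf [set \sum_(0 <= k <oo) diam_pow s (U k) | U in delta_cover delta A].

(* The supremum over delta > 0 is the limit as delta tends to 0, by
   monotonicity. *)
Definition hausdorff_measure s A : \bar R :=
  ereal_sup [set hausdorff_premeasure s delta A |
             delta in [set d : R | (0 < d)%R]].

Definition hausdorff_dim A : \bar R :=
  ereal_inf [set s%:E | s in
    [set s : R | (0 <= s)%R /\ hausdorff_measure s A = 0]].

End hausdorff_dimension.

(* Main.v *)
Require Import Defs.
From mathcomp Require Import all_boot all_order all_algebra.
From mathcomp Require Import reals ereal.
From mathcomp Require Import classical_sets topology sequences exp.
From mathcomp Require Import lra.

(** Sending [(u, G u)] to [(u, F u)] cannot increase distances by more than a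
constant factor when [F] is Lipschitz: the distance between
two points of a graph dominates the distance between their first coordinates,
and the latter controls how far apart the values of [F] are.  Since a Lipschitz
map does not increase Hausdorff dimension ([hausdorff_dim_lipschitz]), the graph
of a Lipschitz map has dimension at most that of any other graph
([hausdorff_dim_graph01_le]), so the graphs of any two Lipschitz maps have the
same dimension.

It remains to see that [F + T] is Lipschitz.  This holds with constant [l + l],
because the Minkowski sum is nonexpansive for the sum of the Hausdorff
distances ([mdist_minkowski_sum]): approximating [a] by [a'] and [b] by [b']
approximates [a + b] by [a' + b'] up to the sum of the errors. *)

Import Order.TTheory GRing.Theory Num.Theory.

Local Open Scope classical_set_scope.
Local Open Scope ring_scope.

Section lipschitz_images.
Context {R : realType} {M N : metricType R}.
Variables (f : M -> N) (A : set M) (c : R).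
Hypothesis c_gt0 : 0 < c.
Hypothesis f_lipschitz :
  forall x y, A x -> A y -> mdist (f x) (f y) <= c * mdist x y.
Local Open Scope ereal_scope.

Let diam_ge0 (L : metricType R) (U : set L) : 0 <= diam U.
Proof. by apply: ereal_sup_ubound; left. Qed.

Let diam_pow_ge0 (L : metricType R) (s : R) (U : set L) : 0 <= diam_pow s U.
Proof. by rewrite /diam_pow; case: ifP => // _; exact: poweR_ge0. Qed.

Lemma diam_lipschitz (U : set M) : diam (f @` (U `&` A)) <= c%:E * diam U.
Proof.
apply: ge_ereal_sup => z [->|]; first by rewrite mule_ge0// lee_fin ltW.
move=> [_ [x [Ux Ax] <-]] [_ [y [Uy Ay] <-]] <-.
apply: (@le_trans _ _ (c%:E * (mdist x y)%:E)).
  by rewrite -EFinM lee_fin f_lipschitz.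
rewrite lee_pmul2l ?lte_fin//; apply: ereal_sup_ubound; right.
by exists x => //; exists y.
Qed.

Lemma diam_pow_lipschitz (s : R) (U : set M) : (0 <= s)%R ->
  diam_pow s (f @` (U `&` A)) <= (c `^ s)%:E * diam_pow s U.
Proof.
move=> s0; rewrite {1}/diam_pow; case: eqVneq => [_|fUA0].
  by rewrite mule_ge0// lee_fin powR_ge0.
(* At [s = 0] a nonempty image contributes 1, so the source must be known to be
   nonempty for it to contribute as much. *)
have U0 : U != set0 by apply: contraNneq fUA0 => ->; rewrite set0I image_set0.
rewrite /diam_pow (negbTE U0) -poweR_EFin -poweRM ?lee_fin ?(ltW c_gt0)//.
apply: (gt0_ler_poweR s0); last exact: diam_lipschitz.
  by rewrite in_itv/= leey andbT.
by rewrite in_itv/= leey andbT mule_ge0// lee_fin ltW.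
Qed.

(** The images of the pieces [U k `&` A] of a cover of [A] form a cover of
[f @` A]; cutting by [A] is what lets the Lipschitz bound, known on [A] only,
be applied.  Their diameters grow by [c], whence the rescaled mesh. *)
Lemma hausdorff_premeasure_lipschitz (s delta : R) : (0 <= s)%R ->
  hausdorff_premeasure s delta (f @` A) <=
  (c `^ s)%:E * hausdorff_premeasure s (delta / c) A.
Proof.
move=> s0; rewrite -ereal_inf_pZl ?powR_gt0//.
apply: le_ereal_inf_tmp => _ [_ [U [AU Ud] <-] <-].
apply: ge_ereal_inf; exists (\sum_(0 <= k <oo) diam_pow s (f @` (U k `&` A))).
  exists (fun k => f @` (U k `&` A)) => //; split => [_ [x Ax <-]|k].
    by have [k _ Ukx] := AU _ Ax; exists k => //; exists x.
  apply: (le_trans (diam_lipschitz _)).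
  have -> : delta%:E = c%:E * (delta / c)%:E.
    by rewrite -EFinM mulrC divfK// gt_eqF.
  by rewrite lee_pmul2l ?lte_fin.
rewrite -nneseriesZl//.
by apply: lee_nneseries => // k _; exact: diam_pow_lipschitz.
Qed.

Lemma hausdorff_measure_lipschitz (s : R) : (0 <= s)%R ->
  hausdorff_measure s (f @` A) <= (c `^ s)%:E * hausdorff_measure s A.
Proof.
move=> s0; apply: ge_ereal_sup => _ [delta /= delta0 <-].
apply: (le_trans (hausdorff_premeasure_lipschitz _ _ s0)).
rewrite lee_pmul2l ?lte_fin ?powR_gt0//; apply: ereal_sup_ubound.
by exists (delta / c)%R => //=; rewrite divr_gt0.
Qed.

Lemma hausdorff_measure_ge0 (L : metricType R) (s : R) (B : set L) :
  0 <= hausdorff_measure s B.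
Proof.
apply: le_ereal_sup_tmp; exists (hausdorff_premeasure s 1 B).
  by exists 1%R => //=.
by apply: le_ereal_inf_tmp => _ [U _ <-]; exact: nneseries_ge0.
Qed.

Lemma hausdorff_dim_lipschitz : hausdorff_dim (f @` A) <= hausdorff_dim A.
Proof.
apply: ereal_inf_le_tmp => _ [s [s0 As] <-]; exists s => //; split => //.
apply/eqP; rewrite eq_le hausdorff_measure_ge0 andbT.
by rewrite (le_trans (hausdorff_measure_lipschitz _ s0))// As mule0.
Qed.

End lipschitz_images.

Section minkowski_sums.
Context {R : realType}.
Implicit Types A B : compacts R.

Lemma excess_minkowski_sum A B A' B' :
  excess (minkowski_sum A B) (minkowski_sum A' B') <= excess A A' + excess B B'.
Proof.
apply: excess_le => _ [a Aa [b Bb <-]]; apply/ler_addgt0Pr => e e0.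
have e20 : 0 < e / 2 by rewrite divr_gt0.
have [a' Aa' aa'] := dist_to_set_adherent a A' e20.
have [b' Bb' bb'] := dist_to_set_adherent b B' e20.
have Sab' : compacts_set (minkowski_sum A' B') (a' + b').
  by exists a' => //; exists b'.
apply: (le_trans (dist_to_set_le (a + b) Sab')).
rewrite opprD addrACA (le_trans (ler_normD _ _))//.
have := dist_to_set_excess A' Aa; have := dist_to_set_excess B' Bb.
by move: aa' bb'; lra.
Qed.

Lemma mdist_minkowski_sum A B A' B' :
  mdist (minkowski_sum A B) (minkowski_sum A' B') <= mdist A A' + mdist B B'.
Proof.
rewrite !compacts_mdistE ge_max; apply/andP; split;
  by rewrite (le_trans (excess_minkowski_sum _ _ _ _))//
    lerD// le_max lexx ?orbT.
Qed.

Lemma lipschitz01_minkowski_fun (l m : R) (F T : R -> compacts R) :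
  lipschitz01 l F -> lipschitz01 m T ->
  lipschitz01 (l + m) (minkowski_fun F T).
Proof.
move=> hF hT u w hu hw; apply: (le_trans (mdist_minkowski_sum _ _ _ _)).
by rewrite mulrDl lerD ?hF ?hT.
Qed.

End minkowski_sums.

(** [graph01 F] is the image of [graph01 G] under a map that reads only the
first coordinate, hence is Lipschitz as soon as [F] is. *)
Lemma hausdorff_dim_graph01_le (R : realType) (l : R) (F G : R -> compacts R) :
  lipschitz01 l F ->
  (hausdorff_dim (graph01 F) <= hausdorff_dim (graph01 G))%E.
Proof.
move=> hF; pose lift (p : graph_space R) : graph_space R := (p.1, F p.1).
have -> : graph01 F = lift @` graph01 G.
  apply/seteqP; split => [_ [u hu <-]|_ [_ [u hu <-] <-]]; last by exists u.
  by exists (u, G u) => //; exists u.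
(* The constant [l] may be negative, and the factor must be positive. *)
apply: (@hausdorff_dim_lipschitz _ _ _ _ _ (1 + `|l|)).
  by rewrite ltr_pwDl.
move=> _ _ [u hu <-] [w hw <-]; rewrite !graph_mdistE /=.
apply: (@le_trans _ _ ((1 + `|l|) * `|u - w|)).
  by rewrite mulrDl mul1r lerD2l (le_trans (hF _ _ hu hw))//
    ler_wpM2r// ler_norm.
by rewrite ler_wpM2l ?addr_ge0// lerDl mdist_ge0.
Qed.

Theorem lemma5p12 (R : realType) (l : R) (F T : R -> compacts R)
    (hF : lipschitz01 l F) (hT : lipschitz01 l T) :
  hausdorff_dim (graph01 (minkowski_fun F T)) = hausdorff_dim (graph01 T).
Proof.
apply/eqP; rewrite eq_le; apply/andP; split.
  apply: hausdorff_dim_graph01_le (lipschitz01_minkowski_fun _ _ _ _ hF hT).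
apply: hausdorff_dim_graph01_le hT.
Qed.
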